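(* Fix $\delta\in(0,1)$, $K\ge 1$ and $T\subset\mathbb{R}_0^d$. Let $X_1,\ldots,X_d$ be i.i.d. non-negative random variables such that for some $C>1$ we have $$\forall t\ge K\,\mathbf{E}X_i:\quad \mathbf{P}(X_i\ge t)\ \ge\ C\,\mathbf{P}(X_i\ge 2t).$$ Then there exist a constant $L=L(\delta,C,K)$ and a family $\mathcal{G}\subset\{(x_\ast,W): x_\ast\in\mathbb{R}_0^d,\ W\subset[d]\}$ such that (i) for all $(x_\ast,W)\in\mathcal{G}$ and all $i\in W$: $x_\ast(i)\ge K\,\mathbf{E}X_i$; (ii) $$\Big\{x\in\mathbb{R}_0^d:\ \sup_{t\in T}\sum_{i=1}^d t_i x(i)\ \ge\ L\,\mathbf{E}\sup_{t\in T}\sum_{i=1}^d t_i X_i\Big\}\ \subset\ \bigcup_{(x_\ast,W)\in\mathcal{G}}\{x\in\mathbb{R}_0^d:\ \forall i\in W\ \ x(i)\ge x_\ast(i)\};$$ (iii) $$\sum_{(x_\ast,W)\in\mathcal{G}}\mathbf{P}\big(\forall i\in W\ \ X_i\ge x_\ast(i)\big)\ \le\ \delta.$$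
   Context: $\mathbb{R}_0=[0,\infty)$, $[d]=\{1,\ldots,d\}$, and $x(i)$ denotes the $i$-th coordinate of a vector $x\in\mathbb{R}^d$ (coordinates of $t\in T$ are written $t_i$). The notation $L=L(\delta,C,K)$ means that $L$ depends only on $\delta,C,K$.
   Formalization: T is additionally assumed bounded and to contain a nonzero vector; for T={0} or unbounded T the claim fails, since (ii) would force covering a point with all coordinates below K·E X_i, hence W empty with probability 1>δ. *)

(* Defs.v *)
From HB Require Import structures.
From mathcomp Require Import all_boot all_order all_algebra.
From mathcomp Require Import all_classical all_reals all_analysis.

Set Implicit Arguments.
Unset Strict Implicit.
Unset Printing Implicit Defensive.

Import Order.TTheory GRing.Theory Num.Theory.
Import numFieldNormedType.Exports.

Local Open Scope classical_set_scope.
Local Open Scope ring_scope.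
Local Open Scope ereal_scope.

Definition orthant (R : realType) (d : nat) : set 'rV[R]_d :=
  [set x | forall i : 'I_d, (0 <= x ord0 i)%R].

(* Extended-real valued: -oo for empty T, +oo when the sums are unbounded. *)
Definition lin_sup (R : realType) (d : nat) (T : set 'rV[R]_d)
    (x : 'rV[R]_d) : \bar R :=
  ereal_sup [set (\sum_(i < d) t ord0 i * x ord0 i)%R%:E | t in T].

Definition rv_vector (dd : measure_display) (Omega : measurableType dd)
    (R : realType) (P : probability Omega R) (d : nat)
    (X : 'I_d -> {RV P >-> R}) (w : Omega) : 'rV[R]_d :=
  \row_(i < d) X i w.

(* Expectation of an extended-real valued supremum; the library's 'E_P is
   restricted to real-valued functions. *)
Definition expected_lin_sup (dd : measure_display) (Omega : measurableType dd)
    (R : realType) (P : probability Omega R) (d : nat) (T : set 'rV[R]_d)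
    (X : 'I_d -> {RV P >-> R}) : \bar R :=
  \int[P]_w lin_sup T (rv_vector X w).

Definition mutually_independent (dd : measure_display)
    (Omega : measurableType dd) (R : realType) (P : probability Omega R)
    (d : nat) (X : 'I_d -> {RV P >-> R}) : Prop :=
  forall (J : {set 'I_d}) (B : 'I_d -> set R),
    (forall i, i \in J -> measurable (B i)) ->
    P (\bigcap_(i in [set i : 'I_d | i \in J]) (X i @^-1` B i)) =
    \prod_(i in J) P (X i @^-1` B i).

Definition identically_distributed (dd : measure_display)
    (Omega : measurableType dd) (R : realType) (P : probability Omega R)
    (d : nat) (X : 'I_d -> {RV P >-> R}) : Prop :=
  forall (i j : 'I_d) (B : set R), measurable B ->
    distribution P (X i) B = distribution P (X j) B.

Definition iid (dd : measure_display)
    (Omega : measurableType dd) (R : realType) (P : probability Omega R)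
    (d : nat) (X : 'I_d -> {RV P >-> R}) : Prop :=
  mutually_independent X /\ identically_distributed X.

(* {x | forall i in W, x(i) >= x_*(i)} for a pair g = (x_*, W) *)
Definition dominates (R : realType) (d : nat) (g : 'rV[R]_d * {set 'I_d})
    : set 'rV[R]_d :=
  [set x | forall i : 'I_d, i \in g.2 -> (g.1 ord0 i <= x ord0 i)%R].

(* Main.v *)
(* Let [M] be the expected supremum and [a := K E X_i].  Coordinates are rounded
   down to the grid [0, a, 2a, 4a, ...]; rounding costs a large [x] only a
   constant factor and the term [a * sum t <= K M].  The tail condition says
   that a threshold [2 ^ j] times higher has probability at most [eta] times
   that of the dyadic level itself, with [eta] as small as we like.

   Fix a grid point [x] with [t.x < 5 M / 2] for all [t] in [T] (a sample of the
   [X_i] is such with probability at least 1/2, by Markov), and let [y] be a grid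
   point with [t.y >= 5 M] for some [t].  Among the sets [U] of coordinates of
   [y], overwrite [x] by [y] on [U] to get [z], and take the least [u] for which
   some [U] with [#|U| <= u] and some [t] satisfy
       2 (t.z) - (sum of the 2 u largest t_i z_i) >= 5 M.
   Then [U] lies inside the [2 u] largest coordinates of [z] for [t]: dropping
   [v] coordinates of [U] outside them loses at most [2 v] times a value which
   [2 v] freed top coordinates compensate, contradicting minimality of [u].
   Since [t] may be chosen as a function of [z] alone, [z] leaves at most [4 ^ u]
   possibilities for [U].  Exchanging the roles of [x] and [y] on [U] then shows
   that the average over [x] of the total cost of these fragments of all [y] is
   at most [sum_(u > 0) (4 eta) ^ u], so some admissible [x] gives a cheap
   cover. *)

Require Import Defs.
From HB Require Import structures.
From mathcomp Require Import all_boot all_order all_algebra.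
From mathcomp Require Import all_classical all_reals all_analysis.
From mathcomp Require Import measurable_realfun lra.

Set Implicit Arguments.
Unset Strict Implicit.
Unset Printing Implicit Defensive.

Import Order.TTheory GRing.Theory Num.Theory.
Import numFieldNormedType.Exports.

Local Open Scope classical_set_scope.
Local Open Scope ring_scope.
Local Open Scope ereal_scope.

(** * Sets carrying the largest values of a function *)

Section top_sets.
Context {R : realType} {I : finType}.
Implicit Types (c : I -> R) (A : {set I}).

(** Ties are allowed, so such a set is not unique. The size is exactly [m] unless the whole type is
    too small to provide it. *)
Definition top_set (m : nat) c A :=
  [/\ (#|A| <= m)%N, forall i b, i \notin A -> b \in A -> (c i <= c b)%R
    & A != [set: I]%SET -> #|A| = m].

Lemma top_set_exists m c : exists A, top_set m c A.
Proof.
elim: m => [|m [A [Am Atop Afull]]].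
  exists finset.set0; split; rewrite ?cards0// => i b _.
  by rewrite inE.
have [AT|/[dup]/Afull cA AnT] := eqVneq A [set: I]%SET.
  by exists A; split => //; [exact: leqW|rewrite AT eqxx].
have [i0 i0A] : exists i0, i0 \notin A.
  apply/existsP; rewrite -negb_forall; apply: contraNN AnT => /forallP allA.
  by apply/eqP/setP => i; rewrite inE allA.
case: (@arg_maxP _ _ _ i0 [pred i | i \notin A] c i0A) => b /= bA bmax.
exists (b |: A)%SET; split.
- by rewrite cardsU1 bA cA.
- move=> i e; rewrite !inE negb_or => /andP[_ iA] /orP[/eqP->|eA].
    exact: bmax.
  exact: Atop.
- by move=> _; rewrite cardsU1 bA cA.
Qed.

End top_sets.

(** * Level functions and overwriting *)

Section overwrite.
Context {I : finType}.
Implicit Types (x g : {ffun I -> nat}) (U : {set I}).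

(** Level 0 doubles as the absence of a value: a set [U] together with nonzero levels on it is a
    single function [g] of support [U]. *)
Definition nsupp g : {set I} := [set i | g i != 0%N]%SET.
Definition nrestr U g : {ffun I -> nat} :=
  [ffun i => if i \in U then g i else 0%N].
Definition overwrite x g : {ffun I -> nat} :=
  [ffun i => if g i != 0%N then g i else x i].

Lemma in_nsupp g i : (i \in nsupp g) = (g i != 0%N). Proof. by rewrite inE. Qed.

Lemma nsupp_nrestr U g : U \subset nsupp g -> nsupp (nrestr U g) = U.
Proof.
move=> /fintype.subsetP sU; apply/setP => i; rewrite inE ffunE; case: ifPn => //.
by move=> /sU; rewrite inE.
Qed.

Lemma overwrite_nrestr x g U i : U \subset nsupp g ->
  overwrite x (nrestr U g) i = if i \in U then g i else x i.
Proof.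
move=> /fintype.subsetP sU; rewrite !ffunE.
by have [/sU|//] := boolP (i \in U); rewrite inE => ->.
Qed.

End overwrite.

(** * Minimal fragments of a bad grid point *)

Section minimal_fragments.
Context {R : realType} {I : finType}.
Variables (T : set (I -> R)) (v : nat -> R) (l : R).
Hypothesis T_ge0 : forall t, T t -> forall i, (0 <= t i)%R.
Hypothesis v_ge0 : forall n, (0 <= v n)%R.
Hypothesis v0 : v 0 = 0%R.
Implicit Types (x y z g : {ffun I -> nat}) (t : I -> R) (U A : {set I}).

(* The coordinates of [z] are counted twice by [t], except for the [2 u]
   heaviest ones, which are counted once. *)
Definition heavy (u : nat) z t := forall A, (#|A| <= u.*2)%N ->
  (l <= \sum_i t i * v (z i) + \sum_(i | i \notin A) t i * v (z i))%R.

(** [F] sees only [z] and [u], not the pair [x], [y] that produced [z]; the subsets of [F z u]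
    therefore number at most [4 ^ u], whatever that pair was. *)
Definition fragment_map (F : {ffun I -> nat} -> nat -> {set I}) :=
  (forall z u, (#|F z u| <= u.*2)%N) /\
  (forall z u, (exists2 t, T t & heavy u z t) ->
     exists t, [/\ T t, heavy u z t
       & top_set u.*2 (fun i => t i * v (z i))%R (F z u)]).

Lemma fragment_map_exists : exists F, fragment_map F.
Proof.
have H (zu : {ffun I -> nat} * nat) : exists A, (#|A| <= zu.2.*2)%N /\
   ((exists2 t, T t & heavy zu.2 zu.1 t) ->
     exists t, [/\ T t, heavy zu.2 zu.1 t
       & top_set zu.2.*2 (fun i => t i * v (zu.1 i))%R A]).
  case: zu => z u /=.
  have [[t Tt ht]|nt] := pselect (exists2 t, T t & heavy u z t).
    have [A topA] := top_set_exists u.*2 (fun i => t i * v (z i))%R.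
    by exists A; split; [case: topA|move=> _; exists t].
  by exists finset.set0; split; [rewrite cards0|move=> /nt].
have [F HF] := choice H.
by exists (fun z u => F (z, u)); split => z u; have [] := HF (z, u).
Qed.

(** Put [V = U :\: A]. Restoring [x] on [V] costs at most twice the [c]-mass of [V]. The allowance
    for removed coordinates shrinks by [2 #|V|], so every admissible [B] leaves enough of [A]
    uncovered to pay for both [V] and [B :\: A]. *)
Lemma heavy_drop u z t U A y x : T t -> heavy u z t ->
  top_set u.*2 (fun i => t i * v (z i))%R A ->
  U \subset nsupp y -> z = overwrite x (nrestr U y) ->
  (#|U| <= u)%N -> ~~ (U \subset A) ->
  heavy (u - #|U :\: A|) (overwrite x (nrestr (U :&: A) y)) t.
Proof.
move=> Tt hz [Au Atop Afull] Uy zE Uu UA B Bu.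
set c := fun i => (t i * v (z i))%R.
set c' := fun i => (t i * v (overwrite x (nrestr (U :&: A) y) i))%R.
set V := (U :\: A)%SET.
have c_ge0 i : (0 <= c i)%R by rewrite mulr_ge0 ?T_ge0.
have c'_ge0 i : (0 <= c' i)%R by rewrite mulr_ge0 ?T_ge0.
have UAy : U :&: A \subset nsupp y.
  by apply: fintype.subset_trans Uy; rewrite finset.subsetIl.
have cc' i : i \notin V -> c' i = c i.
  move=> iV; rewrite /c' /c zE !overwrite_nrestr//.
  by move: iV; rewrite !inE; case: (i \in U) => //=; case: (i \in A).
(* If [A] were everything it would contain [U]. *)
have cA : #|A| = u.*2.
  apply: Afull; apply: contraNneq UA => ->; exact: finset.subsetT.
have Vu : (#|V| <= u)%N.
  by apply: leq_trans Uu; apply: subset_leq_card; rewrite finset.subsetDl.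
(* [#|B| + 2 #|V| <= 2 u = #|A|], and [A :&: B] cancels. *)
have cAB : (#|B :\: A| + #|V|.*2 <= #|A :\: B|)%N.
  have := leq_trans (leq_add Bu (leqnn #|V|.*2)); rewrite doubleB.
  move=> /(_ u.*2); rewrite subnK ?leq_double// => /(_ (leqnn _)).
  rewrite -cA -(cardsID B A) -(cardsID A B) (finset.setIC B) -addnA leq_add2l.
  exact.
have [b0 b0A] : exists b0, b0 \in A.
  apply/set0Pn; rewrite -card_gt0 cA double_gt0 (leq_trans _ Vu)//.
  rewrite card_gt0; apply: contraNneq UA => /eqP.
  by rewrite finset.setD_eq0.
(* The least value on [A] separates it from the outside, so masses compare through cardinalities. *)
pose tau := c [arg min_(b < b0 in A) c b]%O.
have [tauA tauC] : (forall b, b \in A -> (tau <= c b)%R) /\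
    (forall i, i \notin A -> (c i <= tau)%R).
  rewrite /tau; case: (@arg_minP _ _ _ b0 [pred i in A] c b0A) => b bA bmin.
  by split => // i iA; exact: Atop.
have sumC (E : {set I}) : (forall i, i \in E -> i \notin A) ->
    (\sum_(i in E) c i <= tau *+ #|E|)%R.
  by move=> EA; rewrite -sumr_const; apply: ler_sum => i /EA; exact: tauC.
have sumA : (tau *+ #|A :\: B| <= \sum_(i in A :\: B) c i)%R.
  by rewrite -sumr_const; apply: ler_sum => i; rewrite inE => /andP[_]; exact: tauA.
have tau_ge0 : (0 <= tau)%R by exact: c_ge0.
have key : (\sum_(i in B :\: A) c i + \sum_(i in V) c i + \sum_(i in V) c i
    <= \sum_(i in A :\: B) c i)%R.
  apply: le_trans sumA; apply: le_trans (ler_wpMn2l tau_ge0 cAB).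
  rewrite -addnn !mulrnDr addrA; apply: lerD; first apply: lerD; apply: sumC => i;
    by rewrite inE => /andP[].
(* [c] and [c'] differ only on [V], outside [A]; there the two copies of [c] on the left are matched
   by the two sums over [V]. *)
have split_sum : (\sum_i c i + \sum_(i | i \notin A) c i + \sum_(i in A :\: B) c i
    <= \sum_i c' i + \sum_(i | i \notin B) c' i
     + \sum_(i in B :\: A) c i + \sum_(i in V) c i + \sum_(i in V) c i)%R.
  rewrite [X in (_ + X + _ <= _)%R]big_mkcond [X in (_ + _ + X <= _)%R]big_mkcond.
  rewrite [X in (_ <= _ + X + _ + _ + _)%R]big_mkcond/=.
  rewrite [X in (_ <= _ + X + _ + _)%R]big_mkcond/=.
  rewrite [X in (_ <= _ + X + X)%R]big_mkcond/=.
  rewrite -!big_split/=.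
  apply: ler_sum => i _; have := cc' i.
  have -> : (i \in V) = (i \notin A) && (i \in U) by rewrite inE.
  rewrite !inE; have := c_ge0 i; have := c'_ge0 i.
  case: (i \in A) => /=; case: (i \in B) => /=; case: (i \in U) => /= ? ?;
    (try by move=> /(_ isT) ?; lra); move=> _; lra.
have := hz A Au.
rewrite -/c -/c'; move: key split_sum; lra.
Qed.

Lemma fragment_exists F x y : fragment_map F ->
  (forall t, T t -> (\sum_i t i * v (x i) < l / 2)%R) ->
  (exists2 t, T t & (l <= \sum_i t i * v (y i))%R) ->
  exists U, [/\ U != finset.set0, U \subset nsupp y
    & U \subset F (overwrite x (nrestr U y)) #|U|].
Proof.
move=> [_ HF] good [t0 Tt0 bad].
pose Q u := `[< exists U, [/\ U \subset nsupp y, (#|U| <= u)%N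
  & exists2 t, T t & heavy u (overwrite x (nrestr U y)) t] >].
have exQ : exists u, Q u.
  (* With [U] the whole support of [y], the overwritten point dominates [y], so the first of the two
     sums already reaches [l]. *)
  exists #|nsupp y|; apply/asboolP; exists (nsupp y); split => //.
  exists t0 => // A _; apply: (le_trans bad).
  rewrite -[leLHS]addr0; apply: lerD; last first.
    by apply: sumr_ge0 => i _; rewrite mulr_ge0 ?T_ge0.
  apply: ler_sum => i _; rewrite overwrite_nrestr// inE.
  by case: ifPn => [//|/negbNE/eqP->]; rewrite v0 mulr0 mulr_ge0 ?T_ge0.
case: (ex_minnP exQ) => u /asboolP[U [Uy Uu [t Tt hU]]] umin.
(* For [u = 0] heaviness reads [2 (t.x) >= l]; this is why a good [x] stays below [l / 2]. *)
have u_gt0 : (0 < u)%N.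
  rewrite lt0n; apply/eqP => u0; move: Uu hU; rewrite u0 leqn0 cards_eq0.
  move=> /eqP -> /(_ finset.set0); rewrite cards0 => /(_ isT).
  rewrite [X in (_ + X)%R](eq_bigl predT); last by move=> i; rewrite inE.
  rewrite [X in (l <= X + X)%R](eq_bigr (fun i => t i * v (x i))%R); last first.
    by move=> i _; rewrite overwrite_nrestr ?finset.sub0set// inE.
  have := good _ Tt; lra.
(* A smaller [U] would also serve for [u.-1], since heaviness for [u] tests more sets [A]. *)
have cU : #|U| = u.
  apply/eqP; rewrite eqn_leq Uu leqNgt; apply/negP => Ultu.
  have /umin : Q u.-1.
    apply/asboolP; exists U; split => //; first by rewrite -ltnS prednK.
    by exists t => // A Au; apply: hU; apply: leq_trans Au _; rewrite leq_double leq_pred.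
  by rewrite leqNgt prednK// leqnn.
have cardI A : (#|U :&: A| <= u - #|U :\: A|)%N.
  by rewrite -cU -(cardsID A U) addnK.
exists U; split => //; first by rewrite -card_gt0 cU.
rewrite cU; set z := overwrite _ _.
(* The witness [t] is traded for the [t'] behind [F z u], which need not equal it. *)
have [t' [Tt' ht' top]] := HF z u (ex_intro2 _ _ t Tt hU).
apply: contraT => UA.
have /umin : Q (u - #|U :\: F z u|)%N.
  apply/asboolP; exists (U :&: F z u); split.
  - by apply: fintype.subset_trans Uy; rewrite finset.subsetIl.
  - exact: cardI.
  - by exists t' => //; apply: heavy_drop top _ _ _ _ => //.
rewrite leqNgt ltn_subrL u_gt0 andbT card_gt0 finset.setD_eq0.
by rewrite UA.
Qed.

End minimal_fragments.

(** * Sums over arbitrary index sets *)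

Section esum_lemmas.
Context {R : realType}.

Lemma subset_esum (J : choiceType) (A B : set J) (a : J -> \bar R) :
  A `<=` B -> (forall j, B j -> 0 <= a j) ->
  \esum_(j in A) a j <= \esum_(j in B) a j.
Proof.
move=> AB a0; rewrite [leRHS](esumID A)// classical_sets.setIC.
rewrite (classical_sets.setIidl AB) leeDl// esum_ge0// => j [Bj _].
exact: a0.
Qed.

Lemma esumZl (J : choiceType) (A : set J) (a : J -> \bar R) (c : R) :
  (0 <= c)%R -> (forall j, 0 <= a j) ->
  \esum_(j in A) (c%:E * a j) = c%:E * \esum_(j in A) a j.
Proof.
move=> c0 a0.
have le_scale (e : R) (b : J -> \bar R) : (0 <= e)%R -> (forall j, 0 <= b j) ->
    \esum_(j in A) (e%:E * b j) <= e%:E * \esum_(j in A) b j.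
  move=> e0 b0; apply: ge_ereal_sup => _ [X [finX XA] <-].
  rewrite -ge0_mule_fsumr//.
  by apply: lee_wpmul2l; rewrite ?lee_fin//; apply: ereal_sup_ubound; exists X.
apply/eqP; rewrite eq_le le_scale//=.
have [->|cn0] := eqVneq c 0%R.
  by rewrite mul0e esum_ge0// => j _; rewrite mul0e.
(* The reverse inequality is [le_scale] for the factor [c^-1]. *)
rewrite -[leRHS]mul1e -[in leRHS](@mulfV _ c)// EFinM -muleA lee_wpmul2l ?lee_fin//.
apply: le_trans (le_scale _ _ _ _) => //; last 2 first.
- by rewrite invr_ge0.
- by move=> j; rewrite mule_ge0// ?lee_fin.
by apply: le_esum => j Aj; rewrite muleA -EFinM mulVf// mul1e.
Qed.

End esum_lemmas.

(** * Geometric weights of subsets *)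

Lemma geometric_sum_le2 (R : realType) (q : R) n :
  (0 <= q)%R -> (q <= 2^-1)%R -> (\sum_(k < n) q ^+ k <= 2)%R.
Proof.
move=> q0 q2; elim: n => [|n ih]; first by rewrite big_ord0.
rewrite big_ord_recl expr0; under eq_bigr do rewrite lift0 exprS.
rewrite -mulr_sumr.
have s0 : (0 <= \sum_(k < n) q ^+ k)%R by apply: sumr_ge0 => k _; rewrite exprn_ge0.
by have := ler_pM q0 s0 q2 ih; lra.
Qed.

(** Sorted by size [u > 0], the sets [U] are among the at most [4 ^ u] subsets of [A u]; the sum is
    below the series of [(4 * eta) ^ u], whose ratio is at most 1/2. *)
Lemma sum_subsets_le (R : realType) (I : finType) (eta : R) (A : nat -> {set I}) :
  (0 <= eta)%R -> (eta <= 8^-1)%R -> (forall u, (#|A u| <= u.*2)%N) ->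
  (\sum_(U : {set I} | (U != finset.set0) && (U \subset A #|U|)) eta ^+ #|U|
    <= 8 * eta)%R.
Proof.
move=> eta0 eta8 cA; pose N := #|I|.
apply: (@le_trans _ _ (\sum_(u < N) \sum_(U : {set I} | U \subset A u.+1) eta ^+ u.+1)%R).
  rewrite (exchange_big_dep predT)//= [leLHS]big_mkcond/=; apply: ler_sum => U _.
  case: ifPn => [/andP[U0 UA]|_]; last by apply: sumr_ge0 => *; rewrite exprn_ge0.
  have cU : (#|U|.-1.+1 = #|U|)%N by rewrite prednK// card_gt0.
  have UN : (#|U|.-1 < N)%N by rewrite cU max_card.
  rewrite (bigD1 (Ordinal UN))/= ?cU// lerDl; apply: sumr_ge0 => *.
  by rewrite exprn_ge0.
apply: (@le_trans _ _ (\sum_(u < N) (4 * eta) ^+ u.+1)%R).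
  apply: ler_sum => u _; rewrite sumr_const.
  have -> : #|[pred U : {set I} | U \subset A u.+1]| = (2 ^ #|A u.+1|)%N.
    by rewrite -card_powerset; apply: eq_card => U; rewrite !inE.
  rewrite exprMn -[leLHS]mulr_natl ler_wpM2r ?exprn_ge0//.
  have -> : (4 : R)%R = (2 ^+ 2)%R by rewrite expr2; lra.
  by rewrite natrX -exprM ler_weXn2l ?ler1n// mul2n.
under eq_bigr do rewrite exprS.
rewrite -mulr_sumr.
have := @geometric_sum_le2 R (4 * eta) N; set s := (\sum_(_ < _) _)%R => h.
have : (s <= 2)%R by apply: h; lra.
by nra.
Qed.

(** * Averaging the cost of fragments over the base point *)

Section counting.
Context {R : realType} {I : finType}.
Variables (r : I -> nat -> R) (F : {ffun I -> nat} -> nat -> {set I}).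
Hypothesis r_ge0 : forall i k, (0 <= r i k)%R.
Hypothesis cF : forall z u, (#|F z u| <= u.*2)%N.
Implicit Types (x z g h : {ffun I -> nat}) (U : {set I}).

(** For independent variables with level probabilities [r], this is the probability that the
    coordinates in [U] have the levels [h]. *)
Definition weight U h : R := (\prod_(i in U) r i (h i))%R.

Hypothesis weight_le1 : forall U,
  \esum_(h in [set h | nsupp h \subset U]) (weight U h)%:E <= 1.

Let p x := weight [set: I]%SET x.

Definition fragments x : set {ffun I -> nat} :=
  [set g | nsupp g != finset.set0 /\ nsupp g \subset F (overwrite x g) #|nsupp g|].

Lemma weight_ge0 U h : (0 <= weight U h)%R.
Proof. by apply: prodr_ge0. Qed.

(** Factor by factor: on the support of [g] the levels of [x] and [g] trade places, elsewhere
    nothing changes. *)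
Lemma weight_swap x g :
  (p x * weight (nsupp g) g =
   p (overwrite x g) * weight (nsupp g) (nrestr (nsupp g) x))%R.
Proof.
have mkcond U h : weight U h = (\prod_i (if i \in U then r i (h i) else 1))%R.
  by rewrite /weight big_mkcond.
rewrite /p !mkcond -!big_split/=; apply: eq_bigr => i _.
rewrite !inE !ffunE inE; case: (g i != 0)%N; last by [].
by rewrite mulrC.
Qed.

Let frag U x := [set g | nsupp g = U /\ U \subset F (overwrite x g) #|U|].

(** The exchange sends [(x, g)] to the overwritten point [z] and the lost levels [h] of [x] on [U].
    It preserves weight and is injective, because [U] is known. Summing out [h] costs a factor at
    most 1. *)
Lemma fixed_support_le U :
  \esum_(x in [set: {ffun I -> nat}]) \esum_(g in frag U x) (p x * weight U g)%:E
  <= \esum_(z in [set z | U \subset F z #|U|]) (p z)%:E.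
Proof.
pose e (k : {ffun I -> nat} * {ffun I -> nat}) := (overwrite k.1 k.2, nrestr U k.1).
pose b (k : {ffun I -> nat} * {ffun I -> nat}) := (p k.1 * weight U k.2)%:E.
have b_ge0 k : 0 <= b k by rewrite lee_fin mulr_ge0 ?weight_ge0.
rewrite esum_esum; last by move=> *; rewrite lee_fin mulr_ge0 ?weight_ge0.
rewrite (eq_esum (b := fun k => b (e k))); last first.
  by move=> [x g]/= [_ [gU _]]; rewrite /b /e/= -gU weight_swap.
rewrite -(@esum_image _ _ _ _ e b); last first.
  move=> [x g] [x' g']; rewrite !inE/= => -[_ [gU _]] [_ [gU' _]].
  move=> [/ffunP E1 /ffunP E2].
  have suppE (g0 : {ffun I -> nat}) i : nsupp g0 = U -> (g0 i != 0%N) = (i \in U).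
    by move=> <-; rewrite in_nsupp.
  have gg' : g = g'.
    apply/ffunP => i; have := E1 i; rewrite !ffunE !suppE//.
    case: ifPn => // iU _.
    have := suppE _ i gU; have := suppE _ i gU'; rewrite (negbTE iU).
    by move=> /negbFE/eqP-> /negbFE/eqP->.
  rewrite -gg'; congr pair; apply/ffunP => i; have := E1 i; have := E2 i.
  by rewrite !ffunE !suppE//; case: (i \in U).
(* [x] may have level 0 inside [U], so the support of [h] is only included in [U]. *)
apply: (@le_trans _ _ (\esum_(k in [set z | U \subset F z #|U|] `*``
    (fun=> [set h | nsupp h \subset U])) b k)).
  apply: subset_esum => // _ [[x g] /= [_ [gU UF]] <-]; split => //=.
  by apply/fintype.subsetP => i; rewrite inE ffunE; case: ifPn.
rewrite -(@esum_esum R _ _ _ _ (fun z h => (p z * weight U h)%:E)); last first.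
  by move=> *; rewrite lee_fin mulr_ge0 ?weight_ge0.
apply: le_esum => z _; under eq_esum do rewrite EFinM.
rewrite esumZl ?weight_ge0//; last by move=> *; rewrite lee_fin weight_ge0.
by rewrite -[leRHS]mule1 lee_wpmul2l// lee_fin weight_ge0.
Qed.

(** Fragments are sorted by support [U], each support is bounded by [fixed_support_le], and for each
    [z] the supports left are subsets of [F z #|U|], summed by [sum_subsets_le]. *)
Lemma expected_fragment_weight_le (eta : R) : (0 <= eta)%R -> (eta <= 8^-1)%R ->
  \esum_(x in [set: {ffun I -> nat}]) ((p x)%:E *
    \esum_(g in fragments x) (eta ^+ #|nsupp g| * weight (nsupp g) g)%:E)
  <= (8 * eta)%:E.
Proof.
move=> eta0 eta8.
pose Un := [pred U : {set I} | U != finset.set0].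
apply: (@le_trans _ _ (\esum_(x in [set: {ffun I -> nat}]) \sum_(U | Un U)
    (eta ^+ #|U|)%:E * \esum_(g in frag U x) (p x * weight U g)%:E)).
  apply: le_esum => x _; rewrite -esumZl ?weight_ge0//; last first.
    by move=> *; rewrite lee_fin mulr_ge0 ?weight_ge0 ?exprn_ge0.
  under [leRHS]eq_bigr => U _.
    rewrite -esumZl ?exprn_ge0//; last by move=> *; rewrite lee_fin mulr_ge0 ?weight_ge0.
    rewrite esum_mkcond; over.
  rewrite -esum_sum; last first.
    move=> g U _ _; case: ifPn => // _.
    by rewrite mule_ge0// lee_fin ?mulr_ge0 ?weight_ge0 ?exprn_ge0.
  rewrite esum_mkcond; apply: le_esum => g _.
  have t0 U : 0 <= (if g \in frag U x then
      (eta ^+ #|U|)%:E * (p x * weight U g)%:E else 0).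
    by case: ifPn => // _; rewrite mule_ge0// lee_fin ?mulr_ge0 ?weight_ge0 ?exprn_ge0.
  case: ifPn => [|_]; last by apply: sume_ge0 => U _; exact: t0.
  rewrite inE => -[g0 gF]; rewrite (bigD1 (nsupp g))//= mem_set; last by split.
  rewrite -!EFinM mulrCA leeDl// sume_ge0// => U _; exact: t0.
rewrite esum_sum; last first.
  move=> x U _ _; rewrite mule_ge0// ?lee_fin ?exprn_ge0// esum_ge0// => g _.
  by rewrite lee_fin mulr_ge0 ?weight_ge0.
apply: (@le_trans _ _ (\sum_(U | Un U) \esum_(z in [set: {ffun I -> nat}])
    if z \in [set z | U \subset F z #|U|] then (eta ^+ #|U| * p z)%:E else 0)).
  apply: lee_sum => U _; rewrite esumZl ?exprn_ge0//; last first.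
    by move=> x; apply: esum_ge0 => g _; rewrite lee_fin mulr_ge0 ?weight_ge0.
  rewrite -esum_mkcond; under [leRHS]eq_esum do rewrite EFinM.
  rewrite esumZl ?exprn_ge0//; last by move=> *; rewrite lee_fin weight_ge0.
  by rewrite lee_wpmul2l ?lee_fin ?exprn_ge0// fixed_support_le.
rewrite -esum_sum; last first.
  move=> z U _ _; case: ifPn => // _.
  by rewrite lee_fin ?mulr_ge0 ?weight_ge0 ?exprn_ge0.
apply: (@le_trans _ _ (\esum_(z in [set: {ffun I -> nat}]) (8 * eta)%:E * (p z)%:E)).
  apply: le_esum => z _.
  rewrite -big_mkcondr/= sumEFin -mulr_suml lee_fin ler_wpM2r ?weight_ge0//.
  rewrite (eq_bigl [pred U | (U != finset.set0) && (U \subset F z #|U|)]); last first.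
    by move=> U /=; congr andb; rewrite mem_setE.
  exact: sum_subsets_le.
rewrite esumZl; [|by lra|by move=> *; rewrite lee_fin weight_ge0].
have p_le1 : \esum_(z in [set: {ffun I -> nat}]) (p z)%:E <= 1.
  apply: le_trans (weight_le1 [set: I]%SET); apply: subset_esum => //.
    by move=> z _; exact: finset.subsetT.
  by move=> *; rewrite lee_fin weight_ge0.
by rewrite -[leRHS]mule1; apply: lee_wpmul2l => //; rewrite lee_fin; lra.
Qed.

End counting.

(** * The dyadic grid *)

Section dyadic_levels.
Context {R : realType}.
Variable a : R.
Hypothesis a_gt0 : (0 < a)%R.

(** Level 0 includes the negative numbers, so that the levels partition the whole line. *)
Definition level_set (k : nat) : set R :=
  if k is j.+1 then [set x | (a * 2 ^+ j <= x)%R && (x < a * 2 ^+ j.+1)%R]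
  else [set x | (x < a)%R].

Definition level_val (k : nat) : R := if k is j.+1 then (a * 2 ^+ j)%R else 0%R.

Lemma level_val_ge0 k : (0 <= level_val k)%R.
Proof. by case: k => //= k; rewrite mulr_ge0 ?exprn_ge0// ltW. Qed.

Lemma level_set_ub k x : level_set k x -> (x < a * 2 ^+ k)%R.
Proof. by case: k => [|k]/=; rewrite ?expr0 ?mulr1// => /andP[]. Qed.

Lemma level_set_inj k j x : level_set k x -> level_set j x -> k = j.
Proof.
have lt_false k' j' : (k' < j')%N -> level_set k' x -> level_set j' x -> False.
  case: j' => // j'; rewrite ltnS => kj /level_set_ub xk /= /andP[jx _].
  have : (a * 2 ^+ k' <= a * 2 ^+ j')%R.
    by rewrite ler_wpM2l ?(ltW a_gt0)// ler_weXn2l// ler1n.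
  by rewrite leNgt (le_lt_trans jx xk).
move=> kx jx; case: (ltngtP k j) => // /lt_false; first by move=> /(_ kx jx).
by move=> /(_ jx kx).
Qed.

Lemma level_set_cover x : exists k, level_set k x.
Proof.
have ex : exists n, (x < a * 2 ^+ n)%R.
  exists (Num.Def.archi_bound (x / a)).
  by rewrite mulrC -ltr_pdivrMr//; apply: upper_nthrootP.
case: (ex_minnP ex) => -[|n] xn nmin.
  by exists 0%N => /=; move: xn; rewrite expr0 mulr1.
exists n.+1 => /=; rewrite xn andbT leNgt; apply/negP => /nmin.
by rewrite ltnn.
Qed.

Lemma level_exists : exists lev : R -> nat, forall x k, level_set k x <-> lev x = k.
Proof.
have [lev levP] := choice level_set_cover.
by exists lev => x k; split=> [|<-//]; apply: level_set_inj.
Qed.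

Lemma level_val_le k x : (0 <= x)%R -> level_set k x -> (level_val k <= x)%R.
Proof. by case: k => [|k]//= _ /andP[]. Qed.

(** The loss from rounding: at most [a] on level 0, at most a factor 2 above it. *)
Lemma le_level_val k x : level_set k x -> (x <= a + 2 * level_val k)%R.
Proof.
case: k => [|k]/=; first by rewrite mulr0 addr0 => /ltW.
rewrite exprS => /andP[_ /ltW xk]; apply: (le_trans xk).
by rewrite mulrCA lerDr ltW.
Qed.

Lemma level_val_in k : level_set k (level_val k).
Proof.
case: k => //= k; rewrite lexx exprS ltr_pM2l// ltr_pMl ?exprn_gt0//.
by rewrite ltr1n.
Qed.

Lemma level_val_inj : injective level_val.
Proof.
move=> k j kj; apply: (level_set_inj (level_val_in k)).
by rewrite kj; exact: level_val_in.
Qed.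

Lemma ge_level_val k : k != 0%N -> (a <= level_val k)%R.
Proof.
by case: k => // k _ /=; rewrite ler_peMr ?(ltW a_gt0)// exprn_ege1// ler1n.
Qed.

Lemma measurable_level_set k : measurable (level_set k).
Proof.
case: k => [|k] /=.
  rewrite (_ : [set x | _] = `]-oo, a[%classic); first exact: measurable_itv.
  by apply/seteqP; split => x /=; rewrite in_itv.
rewrite (_ : [set x | _] = `[(a * 2 ^+ k)%R, (a * 2 ^+ k.+1)%R[%classic).
  exact: measurable_itv.
by apply/seteqP; split => x /=; rewrite in_itv.
Qed.

End dyadic_levels.

(** * Sums of probabilities and lower integrals *)

Section probability_sums.
Context {R : realType} {dd : measure_display} {Omega : measurableType dd}.
Variable P : probability Omega R.

Lemma esum_probability_le1 (J : choiceType) (D : set J) (E : J -> set Omega) :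
  (forall j, D j -> measurable (E j)) -> trivIset D E ->
  \esum_(j in D) P (E j) <= 1.
Proof.
move=> mE tE; apply: ge_ereal_sup => _ [X [finX XD] <-].
have mX j : X j -> measurable (E j) by move=> /XD; exact: mE.
rewrite -measure_fin_bigcup//; last exact: sub_trivIset tE.
by apply: probability_le1; exact: fin_bigcup_measurable.
Qed.

Lemma probability_bigcup_le_esum (J : countType) (D : set J) (E : J -> set Omega) :
  (forall j, measurable (E j)) ->
  P (\bigcup_(j in D) E j) <= \esum_(j in D) P (E j).
Proof.
move=> mE.
(* The family is enumerated through its codes, with the empty set at numbers that code no index in
   [D]. *)
pose S (n : nat) : set Omega := if @pickle_inv J n is Some j then
  (if j \in D then E j else set0) else set0.
have mS n : measurable (S n).
  by rewrite /S; case: pickle_inv => // j; case: ifP.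
have SE : \bigcup_(j in D) E j = \bigcup_n S n.
  apply/seteqP; split => [w [j Dj Ejw]|w [n _]].
    by exists (pickle j) => //; rewrite /S pickleK_inv mem_set.
  rewrite /S; case: pickle_inv => // j; case: ifPn => //; rewrite inE => Dj Ejw.
  by exists j.
have mU : measurable (\bigcup_n S n) by exact: bigcupT_measurable.
rewrite SE; apply: (le_trans (measure_sigma_subadditive P mS mU (@subset_refl _ _))).
rewrite nneseries_esumT; last by move=> n; exact: measure_ge0.
rewrite (_ : \esum_(i in [set: nat]) P (S i) =
  \esum_(i in (@pickle J) @` D) P (S i)).
  rewrite esum_image; last by move=> x y _ _ /(pcan_inj pickleK).
  by apply: le_esum => j Dj; rewrite /S pickleK_inv mem_set.
rewrite [RHS]esum_mkcond; apply: eq_esum => n _; case: ifPn => //.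
rewrite notin_setE => nD; rewrite /S.
have := @pickle_invK J n; case: pickle_inv => [j|_]; last exact: measure0.
move=> /= jn; case: ifPn => [|_]; last exact: measure0.
by rewrite inE => Dj; exfalso; apply: nD; exists j.
Qed.

(* The integral of a nonnegative function is a
   supremum over simple functions, so no measurability is required. *)
Lemma ge0_le_integral_lower (f g : Omega -> \bar R) :
  (forall w, 0 <= f w) -> (forall w, f w <= g w) ->
  \int[P]_w f w <= \int[P]_w g w.
Proof.
move=> f0 fg; have g0 w : 0 <= g w by exact: le_trans (f0 w) (fg w).
rewrite !ge0_integralTE//; apply: ereal_sup_le => _ [h /= hf <-].
by exists h => // w; exact: le_trans (hf w) (fg w).
Qed.

(** Markov's inequality: [c] times the indicator of [A] lies below [g]. *)
Lemma le_integral_probability (g : Omega -> \bar R) (A : set Omega) (c : R) :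
  measurable A -> (0 <= c)%R -> (forall w, 0 <= g w) ->
  (forall w, A w -> c%:E <= g w) -> c%:E * P A <= \int[P]_w g w.
Proof.
move=> mA c0 g0 cg.
have -> : c%:E * P A = \int[P]_w (c%:E * (\1_A w)%:E).
  rewrite ge0_integralZl_EFin//; last first.
    by apply/measurable_EFinP; exact: measurable_indic.
  by rewrite integral_indic// setIT.
apply: ge0_le_integral_lower => w.
  by rewrite mule_ge0 ?lee_fin.
rewrite indicE; have [/set_mem Aw|_] := boolP (w \in A).
  by rewrite mule1; exact: cg.
by rewrite mule0.
Qed.

End probability_sums.

(** By Bernoulli's inequality [n (C - 1) <= C ^ n]. *)
Lemma expr_unbounded (R : realType) (C x : R) :
  (1 < C)%R -> exists n, (x <= C ^+ n)%R.
Proof.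
move=> C1; have h0 : (0 < C - 1)%R by rewrite subr_gt0.
have bern n : (n%:R * (C - 1) <= C ^+ n)%R.
  elim: n => [|n ih]; first by rewrite mul0r.
  have : (1 <= C ^+ n)%R by rewrite exprn_ege1// ltW.
  by rewrite exprS -natr1; nra.
exists (Num.Def.archi_bound (x / (C - 1))); apply: le_trans (bern _).
rewrite -ler_pdivrMr//; have [x0|x0] := leP 0%R (x / (C - 1))%R.
  exact/ltW/archi_boundP.
by rewrite (le_trans (ltW x0)).
Qed.

(** * Probabilities of levels *)

Section levels_of_random_variables.
Context {R : realType} {dd : measure_display} {Omega : measurableType dd}.
Variable P : probability Omega R.
Variable a : R.
Hypothesis a_gt0 : (0 < a)%R.

Definition level_prob (Y : {RV P >-> R}) (k : nat) : R :=
  fine (P (Y @^-1` level_set a k)).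

Lemma measurable_level (Y : {RV P >-> R}) k : measurable (Y @^-1` level_set a k).
Proof. by apply: measurable_funPTI; exact: measurable_level_set. Qed.

Lemma level_probE (Y : {RV P >-> R}) k :
  (level_prob Y k)%:E = P (Y @^-1` level_set a k).
Proof. by rewrite fineK// fin_num_measure//; exact: measurable_level. Qed.

Lemma level_prob_ge0 (Y : {RV P >-> R}) k : (0 <= level_prob Y k)%R.
Proof. by rewrite -lee_fin level_probE. Qed.

Lemma measurable_ge (Y : {RV P >-> R}) t : measurable [set w | (t <= Y w)%R].
Proof.
rewrite (_ : [set w | _] = Y @^-1` `[t, +oo[%classic).
  by apply: measurable_funPTI; exact: measurable_itv.
by apply/seteqP; split => w /=; rewrite in_itv/= andbT.
Qed.

(* The geometric decay of the tail makes a tail comparable to its first dyadic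
   piece, and each further doubling gains a factor [C]. *)
Lemma tail_le_level_prob (Y : {RV P >-> R}) (C : R) j k :
  (1 < C)%R ->
  (forall t, (a <= t)%R ->
     C%:E * P [set w | (2 * t <= Y w)%R] <= P [set w | (t <= Y w)%R]) ->
  k != 0%N ->
  P [set w | (2 ^+ j * level_val a k <= Y w)%R] <=
    (C ^- j * (C / (C - 1)) * level_prob Y k)%:E.
Proof.
move=> C1 tail; case: k => // k _ /=.
pose q t := fine (P [set w | (t <= Y w)%R]).
have qE t : (q t)%:E = P [set w | (t <= Y w)%R].
  by rewrite fineK// fin_num_measure//; exact: measurable_ge.
have C0 : (0 < C)%R by rewrite (lt_trans _ C1).
have qtail t : (a <= t)%R -> (C * q (2 * t) <= q t)%R.
  by move=> /tail; rewrite -!qE -EFinM lee_fin.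
set s := (a * 2 ^+ k)%R.
have as_ : (a <= s)%R by rewrite /s ler_peMr ?(ltW a_gt0)// exprn_ege1// ler1n.
have step : (q (2 ^+ j * s) <= C ^- j * q s)%R.
  elim: j => [|j ih]; first by rewrite expr0 invr1 !mul1r.
  have ajs : (a <= 2 ^+ j * s)%R.
    by rewrite (le_trans as_)// ler_peMl ?exprn_ege1 ?ler1n// (le_trans (ltW a_gt0)).
  have := qtail _ ajs; rewrite mulrA -exprS => h.
  by rewrite [in leRHS]exprS invfM -mulrA ler_pdivlMl// (le_trans h).
(* The dyadic piece starting at [s] is the difference of the tails at [s] and [2 * s]. *)
have level_diff : level_prob Y k.+1 = (q s - q (2 * s))%R.
  apply: EFin_inj; rewrite level_probE EFinB !qE.
  rewrite (_ : Y @^-1` _ = [set w | (s <= Y w)%R] `\` [set w | (2 * s <= Y w)%R]).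
    have Ps : P [set w | (s <= Y w)%R] < +oo by rewrite -qE ltry.
    rewrite (measureD (measurable_ge Y s) (measurable_ge Y (2 * s)%R) Ps).
    congr (_ - P _); apply/seteqP; split => w /=; first by case.
    move=> h; split => //; rewrite (le_trans _ h)// ler_peMl ?ler1n//.
    exact: le_trans (ltW a_gt0) as_.
  apply/seteqP; split => w /=; rewrite -/s exprS (mulrCA a) -/s.
    by move=> /andP[-> h]; split => //; apply/negP; rewrite -ltNge.
  by move=> [-> /negP]; rewrite -ltNge => ->.
rewrite -qE lee_fin (le_trans step)// -mulrA.
rewrite ler_wpM2l ?invr_ge0 ?exprn_ge0 ?(ltW C0)//.
rewrite level_diff mulrAC ler_pdivlMr ?subr_gt0//.
(* From [q (2 * s) <= q s / C], the piece keeps at least the fraction [(C - 1) / C] of the tail. *)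
have := qtail _ as_; nra.
Qed.

Context {d : nat}.
Variable X : 'I_d -> {RV P >-> R}.
Hypothesis X_indep : mutually_independent X.

Let r i k := level_prob (X i) k.

Lemma probability_levels (U : {set 'I_d}) (h : {ffun 'I_d -> nat}) :
  P (\bigcap_(i in [set i : 'I_d | i \in U]) (X i @^-1` level_set a (h i))) =
  (weight r U h)%:E.
Proof.
rewrite X_indep; last by move=> i _; exact: measurable_level_set.
by rewrite -prodEFin; apply: eq_bigr => i _; rewrite level_probE.
Qed.

Lemma measurable_levels (U : {set 'I_d}) (h : {ffun 'I_d -> nat}) :
  measurable (\bigcap_(i in [set i : 'I_d | i \in U]) (X i @^-1` level_set a (h i))).
Proof.
by apply: fin_bigcap_measurable; [exact: finite_finset|move=> i _; exact: measurable_level].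
Qed.

(** The events are disjoint: an outcome fixes the levels on [U], and off [U] they vanish. *)
Lemma weight_levels_le1 (U : {set 'I_d}) :
  \esum_(h in [set h : {ffun 'I_d -> nat} | nsupp h \subset U]) (weight r U h)%:E <= 1.
Proof.
under eq_esum do rewrite -probability_levels.
apply: esum_probability_le1 => [h _|]; first exact: measurable_levels.
move=> h h' /= /fintype.subsetP hU /fintype.subsetP hU' [w [hw hw']].
apply/ffunP => i; have [iU|iU] := boolP (i \in U).
  exact: (level_set_inj a_gt0 (hw i iU) (hw' i iU)).
have zero (h0 : {ffun 'I_d -> nat}) : {subset nsupp h0 <= U} -> h0 i = 0%N.
  by move=> s; apply: contraNeq iU => h0i; apply: s; rewrite inE.
by rewrite !zero.
Qed.

(** By Markov, outcomes outside every good grid cell have probability at most 1/2, as [f >= 2 * M]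
    there. *)
Lemma half_le_weight_good (good : set {ffun 'I_d -> nat})
    (f : Omega -> \bar R) (M : R) :
  (0 < M)%R -> (forall w, 0 <= f w) -> \int[P]_w f w = M%:E ->
  (forall w (x : {ffun _ -> _}), (forall i, level_set a (x i) (X i w)) ->
     ~ good x -> (2 * M)%:E <= f w) ->
  (2^-1)%:E <= \esum_(x in good) (weight r [set: 'I_d]%SET x)%:E.
Proof.
move=> M0 f0 fM fbad.
pose E (x : {ffun 'I_d -> nat}) : set Omega :=
  \bigcap_(i in [set i : 'I_d | i \in [set: 'I_d]%SET]) (X i @^-1` level_set a (x i)).
have mE x : measurable (E x) by exact: measurable_levels.
pose A := \bigcup_(x in good) E x.
have mA : measurable A.
  rewrite /A bigcup_mkcond; apply: countable_bigcupT_measurable.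
    exact: countableP.
  by move=> x; case: ifP.
have PA : P (~` A) <= (2^-1)%:E.
  have : (2 * M)%:E * P (~` A) <= M%:E.
    rewrite -fM; apply: le_integral_probability => //; first exact: measurableC.
      by rewrite mulr_ge0// ltW.
    move=> w nAw.
    have [x xw] := choice (fun i => level_set_cover a_gt0 (X i w)).
    have xE i : [ffun i => x i] i = x i by rewrite ffunE.
    apply: (fbad w [ffun i => x i]) => [i|gx]; first by rewrite xE.
    by apply: nAw; exists [ffun i => x i] => // i _ /=; rewrite xE.
  have := @fineK _ (P (~` A)) (fin_num_measure _ _ (measurableC mA)).
  move=> <-; rewrite -EFinM !lee_fin => h.
  by rewrite -(ler_pM2l M0) mulrC; move: h; nra.
have : P A <= \esum_(x in good) (weight r [set: 'I_d]%SET x)%:E.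
  under eq_esum do rewrite -probability_levels.
  exact: probability_bigcup_le_esum.
apply: le_trans; move: PA; rewrite probability_setC//.
have := @fineK _ (P A) (fin_num_measure _ _ mA).
by move=> <-; rewrite -EFinB !lee_fin; lra.
Qed.

End levels_of_random_variables.

(** * Choice of a cheap base point *)

Lemma cheap_fragments_exist (R : realType) (I : finType) (r : I -> nat -> R)
    (F : {ffun I -> nat} -> nat -> {set I}) (good : set {ffun I -> nat})
    (eta delta : R) :
  (forall i k, (0 <= r i k)%R) ->
  (forall z u, (#|F z u| <= u.*2)%N) ->
  (forall U : {set I}, \esum_(h in [set h : {ffun I -> nat} | nsupp h \subset U])
     (weight r U h)%:E <= 1) ->
  (2^-1)%:E <= \esum_(x in good) (weight r [set: I]%SET x)%:E ->
  (0 <= eta)%R -> (eta <= delta / 32)%R -> (0 < delta)%R -> (delta < 1)%R ->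
  exists2 x, good x &
    \esum_(g in fragments F x) (eta ^+ #|nsupp g| * weight r (nsupp g) g)%:E
      <= delta%:E.
Proof.
move=> r0 cF w1 half eta0 etad d0 d1.
have eta8 : (eta <= 8^-1)%R by lra.
have := expected_fragment_weight_le r0 cF w1 eta0 eta8.
set S := fun x => \esum_(g in fragments F x) (eta ^+ #|nsupp g| * weight r (nsupp g) g)%:E.
move=> total; apply: contrapT => none.
have costly x : good x -> delta%:E <= S x.
  by move=> gx; rewrite leNgt; apply/negP => /ltW Sx; apply: none; exists x.
have S0 x : 0 <= S x.
  by apply: esum_ge0 => g _; rewrite lee_fin mulr_ge0 ?exprn_ge0 ?weight_ge0.
(* Good points carry mass at least 1/2, so the average cost would be at least [delta / 2], yet it is
   at most [8 * eta <= delta / 4]. *)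
have : delta%:E * (2^-1)%:E <= (8 * eta)%:E.
  apply: le_trans total.
  apply: (@le_trans _ _ (\esum_(x in good) (delta%:E * (weight r [set: I]%SET x)%:E))).
    rewrite esumZl ?(ltW d0)//; last by move=> x; rewrite lee_fin weight_ge0.
    by rewrite lee_wpmul2l// lee_fin ltW.
  apply: (@le_trans _ _ (\esum_(x in good) ((weight r [set: I]%SET x)%:E * S x))).
    apply: le_esum => x /costly gx; rewrite muleC lee_wpmul2l// lee_fin.
    exact: weight_ge0.
  by apply: subset_esum => // x _; rewrite mule_ge0 ?lee_fin ?weight_ge0.
by rewrite -EFinM lee_fin; lra.
Qed.

(** * Expected suprema and means *)

Section expected_suprema.
Context {R : realType} {dd : measure_display} {Omega : measurableType dd}.
Context {P : probability Omega R} {d : nat}.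
Variables (T : set 'rV[R]_d) (X : 'I_d -> {RV P >-> R}).
Hypothesis T_nonneg : T `<=` @orthant R d.
Hypothesis X_nonneg : forall i w, (0 <= X i w)%R.

Lemma lin_sup_ub t (x : 'rV[R]_d) : T t ->
  (\sum_(i < d) t ord0 i * x ord0 i)%R%:E <= lin_sup T x.
Proof. by move=> Tt; apply: ereal_sup_ubound; exists t. Qed.

Lemma lin_sup_ge0 x : T !=set0 -> orthant x -> 0 <= lin_sup T x.
Proof.
move=> [t Tt] x0; apply: le_trans (lin_sup_ub x Tt); rewrite lee_fin.
by apply: sumr_ge0 => i _; rewrite mulr_ge0 ?x0// T_nonneg.
Qed.

Lemma rv_vector_ge0 w : orthant (rv_vector X w).
Proof. by move=> i; rewrite mxE. Qed.

Lemma expectation_le_expected_lin_sup t : T t ->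
  \sum_(i < d) (t ord0 i)%:E * 'E_P[X i] <= expected_lin_sup T X.
Proof.
move=> Tt; have t0 i : (0 <= t ord0 i)%R by exact: T_nonneg.
have -> : \sum_(i < d) (t ord0 i)%:E * 'E_P[X i] =
    \int[P]_w (\sum_(i < d) (t ord0 i)%:E * (X i w)%:E).
  rewrite ge0_integral_sum//.
  - apply: eq_bigr => i _; rewrite unlock ge0_integralZl_EFin//.
      by move=> w _; rewrite lee_fin.
    by apply/measurable_EFinP; exact: measurable_funPT.
  - move=> i; apply: emeasurable_funM; first exact: measurable_cst.
    by apply/measurable_EFinP; exact: measurable_funPT.
  - by move=> i w _; rewrite mule_ge0 ?lee_fin.
apply: ge0_le_integral_lower => w.
  by apply: sume_ge0 => i _; rewrite mule_ge0 ?lee_fin.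
apply: le_trans (lin_sup_ub _ Tt); rewrite -sumEFin; apply: lee_sum => i _.
by rewrite mxE EFinM.
Qed.

Lemma expectation_eq i j : identically_distributed X -> 'E_P[X i] = 'E_P[X j].
Proof.
move=> idX.
(* The absolute value, harmless as [X k] is nonnegative, makes the integrand nonnegative on the
   whole line for the change of variables. *)
have distE k : 'E_P[X k] = \int[distribution P (X k)]_y (`|y|)%:E.
  rewrite unlock ge0_integral_distribution//.
  - by apply: eq_integral => w _ /=; rewrite ger0_norm.
  - by apply/measurable_EFinP; exact: normr_measurable.
rewrite !distE; apply: eq_measure_integral => A mA _; exact: idX.
Qed.

Lemma probability_dominates (a : R) (x : 'rV[R]_d) (g : {ffun 'I_d -> nat})
    (eta : R) :
  mutually_independent X -> (0 <= eta)%R ->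
  (forall i, i \in nsupp g -> P [set w | (x ord0 i <= X i w)%R] <=
     (eta * level_prob a (X i) (g i))%:E) ->
  P [set w | dominates (x, nsupp g) (rv_vector X w)] <=
  (eta ^+ #|nsupp g| * weight (fun i => level_prob a (X i)) (nsupp g) g)%:E.
Proof.
move=> indep eta0 le_eta.
rewrite (_ : [set w | _] = \bigcap_(i in [set i : 'I_d | i \in nsupp g])
    (X i @^-1` `[x ord0 i, +oo[%classic)); last first.
  apply/seteqP; split => w /= h i /h /=; first by rewrite mxE in_itv/= andbT.
  by rewrite mxE in_itv/= andbT.
rewrite indep; last by move=> i _; exact: measurable_itv.
have geE i : X i @^-1` `[x ord0 i, +oo[ = [set w | (x ord0 i <= X i w)%R].
  by apply/seteqP; split => w /=; rewrite in_itv/= andbT.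
have fineE i : P (X i @^-1` `[x ord0 i, +oo[) =
    (fine (P [set w | (x ord0 i <= X i w)%R]))%:E.
  by rewrite geE fineK// fin_num_measure//; exact: measurable_ge.
under eq_bigr do rewrite fineE.
rewrite prodEFin lee_fin /weight -prodr_const -big_split/=.
apply: ler_prod => i ig; rewrite fine_ge0//= -lee_fin -fineE geE.
exact: le_eta.
Qed.

End expected_suprema.

(** * The cover when the expected supremum is finite *)

Section finite_expectation.
Context {R : realType} {dd : measure_display} {Omega : measurableType dd}.
Context {P : probability Omega R} {d : nat}.
Variables (delta C K : R) (j : nat).
Hypotheses (delta_gt0 : (0 < delta)%R) (delta_lt1 : (delta < 1)%R).
Hypotheses (C_gt1 : (1 < C)%R) (K_ge1 : (1 <= K)%R).
Hypothesis j_large : (C ^- j * (C / (C - 1)) <= delta / 32)%R.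
Variables (T : set 'rV[R]_d) (X : 'I_d -> {RV P >-> R}) (mu M : R).
Hypothesis T_nonneg : T `<=` @orthant R d.
Hypothesis T_nonempty : T !=set0.
Hypothesis X_nonneg : forall i w, (0 <= X i w)%R.
Hypothesis X_indep : mutually_independent X.
Hypothesis X_tail : forall (i : 'I_d) (t : R), (K * mu <= t)%R ->
  C%:E * P [set w | (2 * t <= X i w)%R] <= P [set w | (t <= X i w)%R].
Hypothesis X_mean : forall i, 'E_P[X i] = mu%:E.
Hypothesis mu_gt0 : (0 < mu)%R.
Hypothesis M_def : expected_lin_sup T X = M%:E.
Hypothesis M_gt0 : (0 < M)%R.

Let a := (K * mu)%R.
Let a_gt0 : (0 < a)%R. Proof. by rewrite mulr_gt0// (lt_le_trans _ K_ge1). Qed.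
Let T' : set ('I_d -> R) := [set fun i => t ord0 i | t in T].
Let v := level_val a.
Let eta := (C ^- j * (C / (C - 1)))%R.

Let T'_ge0 t : T' t -> forall i, (0 <= t i)%R.
Proof. by move=> [s Ts <-] i; exact: T_nonneg. Qed.

(** [x] is divided by [2 ^+ j] before rounding, so that thresholds [2 ^+ j] above the level values
    still lie below [x]. The additive loss [a * sum t] is at most [K * M], leaving [10 * M] out of
    [(K + 10) * M], and rounding halves it. *)
Lemma large_vector_level (x : 'rV[R]_d) :
  orthant x -> (2 ^+ j.+1 * (K + 10) * M)%:E <= lin_sup T x ->
  exists y : {ffun 'I_d -> nat},
    (forall i, (2 ^+ j * v (y i) <= x ord0 i)%R) /\
    (exists2 t, T' t & (5 * M <= \sum_i t i * v (y i))%R).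
Proof.
move=> x0 xL; have p2 : (0 < 2 ^+ j :> R)%R by rewrite exprn_gt0.
have [lev levP] := level_exists a_gt0.
pose y : {ffun 'I_d -> nat} := [ffun i => lev (x ord0 i / 2 ^+ j)%R].
have yP i : level_set a (y i) (x ord0 i / 2 ^+ j)%R by apply/levP; rewrite ffunE.
exists y; split=> [i|].
  rewrite mulrC -ler_pdivlMr//; apply: level_val_le (yP i).
  by rewrite divr_ge0 ?x0// ltW.
(* One spare factor 2 gives strictness, hence a single [t] exceeding the bound even if the supremum
   is not attained. *)
have : (2 ^+ j * (K + 10) * M)%:E < lin_sup T x.
  have K10 : (0 < K + 10)%R by rewrite addr_gt0// (lt_le_trans ltr01 K_ge1).
  by apply: lt_le_trans xL; rewrite lte_fin !ltr_pM2r// exprS ltr_pMl// ltr1n.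
move=> /ereal_sup_gt[_ [t Tt <-]]; rewrite lte_fin => tx.
have t0 i : (0 <= t ord0 i)%R by exact: T_nonneg.
exists (fun i => t ord0 i); first by exists t.
have muM : (mu * \sum_i t ord0 i <= M)%R.
  have := expectation_le_expected_lin_sup T_nonneg X_nonneg Tt.
  under eq_bigr do rewrite X_mean -EFinM.
  by rewrite M_def sumEFin lee_fin mulr_sumr; under eq_bigr do rewrite mulrC.
have : (\sum_i t ord0 i * x ord0 i <=
    2 ^+ j * (a * \sum_i t ord0 i + 2 * \sum_i t ord0 i * v (y i)))%R.
  rewrite !mulr_sumr -big_split/= mulr_sumr; apply: ler_sum => i _.
  have := le_level_val a_gt0 (yP i); rewrite ler_pdivrMr// -/v => h.
  have := ler_wpM2l (t0 i) h; nra.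
move=> /(lt_le_trans tx); rewrite -mulrA ltr_pM2l// => h.
have : (a * \sum_i t ord0 i <= K * M)%R.
  by rewrite /a -mulrA ler_wpM2l// (le_trans _ K_ge1).
move: h; lra.
Qed.

Lemma cover_finite_expectation : exists G : set ('rV[R]_d * {set 'I_d}),
  [/\ G `<=` [set g | orthant g.1],
      forall g, G g -> forall i, i \in g.2 ->
        K%:E * 'E_P[X i] <= (g.1 ord0 i)%:E,
      [set x | orthant x /\
          (2 ^+ j.+1 * (K + 10))%:E * expected_lin_sup T X <= lin_sup T x]
        `<=` \bigcup_(g in G) [set x | orthant x /\ dominates g x]
    & \esum_(g in G) P [set w | dominates g (rv_vector X w)] <= delta%:E].
Proof.
have v_ge0 k : (0 <= v k)%R by exact: level_val_ge0.
have p2 : (1 <= 2 ^+ j :> R)%R by rewrite exprn_ege1// ler1n.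
have eta_ge0 : (0 <= eta)%R.
  by rewrite mulr_ge0 ?invr_ge0 ?exprn_ge0 ?divr_ge0//; move: C_gt1; lra.
pose r i := level_prob a (X i).
have [F Fmap] := fragment_map_exists T' v (5 * M)%R.
pose good : set {ffun 'I_d -> nat} :=
  [set x | forall t, T' t -> (\sum_i t i * v (x i) < 5 * M / 2)%R].
have half : (2^-1)%:E <= \esum_(x in good) (weight r [set: 'I_d]%SET x)%:E.
  apply: (half_le_weight_good a_gt0 X_indep M_gt0 _ M_def).
    by move=> w; apply: lin_sup_ge0 => //; exact: rv_vector_ge0.
  move=> w x xw /existsNP[t /not_implyP[[s Ts <-]]] /negP; rewrite -leNgt => sx.
  apply: le_trans (lin_sup_ub _ Ts); rewrite lee_fin.
  (* Failing to be good means at least [5 * M / 2], above the [2 * M] of Markov; rounding down only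
     lowered the sum. *)
  apply: (@le_trans _ _ (\sum_i s ord0 i * v (x i))%R); first by move: sx M_gt0; lra.
  apply: ler_sum => i _; rewrite mxE ler_wpM2l//; first exact: T_nonneg.
  exact: level_val_le (xw i).
have [x gx cheap] := cheap_fragments_exist (fun i k => level_prob_ge0 a (X i) k)
  Fmap.1 (weight_levels_le1 a_gt0 X_indep) half eta_ge0 j_large delta_gt0 delta_lt1.
(* Thresholds sit [2 ^+ j] above the levels of [g], which gains a factor [eta] per coordinate. *)
pose emb (g : {ffun 'I_d -> nat}) : 'rV[R]_d * {set 'I_d} :=
  (\row_i (2 ^+ j * v (g i))%R, nsupp g).
exists (emb @` fragments F x); split.
- by move=> _ [g _ <-] i /=; rewrite mxE mulr_ge0 ?exprn_ge0.
- move=> _ [g _ <-] i /=; rewrite in_nsupp => gi; rewrite X_mean mxE lee_fin.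
  apply: le_trans (ge_level_val a_gt0 gi) _.
  by rewrite ler_peMl.
- move=> z [z0]; rewrite M_def -EFinM => /(large_vector_level z0)[y [yz ybad]].
  have [U [U0 Uy UF]] := fragment_exists T'_ge0 v_ge0 (erefl _) Fmap gx ybad.
  exists (emb (nrestr U y)).
    by exists (nrestr U y) => //; split; rewrite nsupp_nrestr.
  split => // i /=; rewrite nsupp_nrestr// => iU.
  by rewrite mxE ffunE iU; exact: yz.
(* The thresholds determine the levels, so no pair is counted for two fragments. *)
- rewrite esum_image; last first.
    move=> g h _ _ [/rowP gh _]; apply/ffunP => i; have := gh i; rewrite !mxE.
    by move=> /(mulfI (lt0r_neq0 (lt_le_trans ltr01 p2)))/(level_val_inj a_gt0).
  apply: le_trans cheap; apply: le_esum => g _.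
  apply: (probability_dominates X_indep eta_ge0) => i; rewrite in_nsupp => gi.
  by rewrite mxE; apply: tail_le_level_prob => // t; exact: X_tail.
Qed.

End finite_expectation.

(** * The constant, and reduction to finite positive expectations *)

Theorem theorem2p3 (R : realType) (delta C K : R)
    (delta_gt0 : (0 < delta)%R) (delta_lt1 : (delta < 1)%R)
    (C_gt1 : (1 < C)%R) (K_ge1 : (1 <= K)%R) :
  exists L : R,
  forall (d : nat) (T : set 'rV[R]_d)
    (T_nonneg : T `<=` @orthant R d)
    (T_nontrivial : exists2 t, T t & t != 0%R)
    (T_bounded : exists M : R, forall t, T t -> forall i, (t ord0 i <= M)%R)
    (dd : measure_display) (Omega : measurableType dd)
    (P : probability Omega R) (X : 'I_d -> {RV P >-> R})
    (X_nonneg : forall i w, (0 <= X i w)%R)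
    (X_iid : iid X)
    (X_tail : forall (i : 'I_d) (t : R), K%:E * 'E_P[X i] <= t%:E ->
      C%:E * P [set w | (2 * t <= X i w)%R] <= P [set w | (t <= X i w)%R]),
  exists G : set ('rV[R]_d * {set 'I_d}),
    [/\ G `<=` [set g | orthant g.1],
        forall g, G g -> forall i, i \in g.2 ->
          K%:E * 'E_P[X i] <= (g.1 ord0 i)%:E,
        [set x | orthant x /\ L%:E * expected_lin_sup T X <= lin_sup T x]
          `<=` \bigcup_(g in G) [set x | orthant x /\ dominates g x]
      & \esum_(g in G) P [set w | dominates g (rv_vector X w)] <= delta%:E].
Proof.
have C0 : (0 < C)%R by rewrite (lt_trans _ C_gt1).
(* [j] makes [eta = C ^- j * (C / (C - 1))] at most [delta / 32]; it depends on [C] and [delta]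
   only. *)
have [j jP] := expr_unbounded (C / (C - 1) / (delta / 32))%R C_gt1.
have j_large : (C ^- j * (C / (C - 1)) <= delta / 32)%R.
  rewrite mulrC ler_pdivrMr ?exprn_gt0// [leRHS]mulrC -ler_pdivrMr//.
  by rewrite divr_gt0.
exists (2 ^+ j.+1 * (K + 10))%R => d T T_nonneg [t0 Tt0 t0_neq0] [B TB].
move=> dd Omega P X X_nonneg [X_indep X_ident] X_tail.
have L_gt0 : (0 < 2 ^+ j.+1 * (K + 10) :> R)%R.
  by rewrite mulr_gt0 ?exprn_gt0//; lra.
have [i0 ti0] : exists i, (0 < t0 ord0 i)%R.
  have [i ti] : exists i, t0 ord0 i != 0%R.
    apply: contrapT => no; move/eqP: t0_neq0; apply; apply/rowP => i; rewrite mxE.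
    by apply: contrapT => /eqP ti; apply: no; exists i.
  by exists i; rewrite lt_neqAle eq_sym ti T_nonneg.
have lin_le := expectation_le_expected_lin_sup T_nonneg X_nonneg Tt0.
(* A positive coordinate in [T] ties the mean to the expected supremum: finiteness passes to the
   mean, positivity back. *)
have term_le : (t0 ord0 i0)%:E * 'E_P[X i0] <= expected_lin_sup T X.
  apply: le_trans lin_le; rewrite (bigD1 i0)//= leeDl// sume_ge0// => i _.
  by rewrite mule_ge0 ?expectation_ge0// lee_fin T_nonneg.
have meanE i : 'E_P[X i] = 'E_P[X i0] by exact: expectation_eq.
(* If the expectation is infinite, nothing is to be covered: for bounded [T], [lin_sup] is never
   [+oo] on the orthant. *)
have [Minf|Mfin] := eqVneq (expected_lin_sup T X) +oo.
  exists set0; split => //; last by rewrite esum_set0 lee_fin ltW.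
  move=> x [x0]; rewrite Minf gt0_muley ?lte_fin// leye_eq => /eqP xoo; exfalso.
  have : lin_sup T x <= (\sum_i B * x ord0 i)%R%:E.
    apply: ge_ereal_sup => _ [t Tt <-]; rewrite lee_fin; apply: ler_sum => i _.
    by rewrite ler_wpM2r ?x0// TB.
  by rewrite xoo.
have mean_ge0 : 0 <= 'E_P[X i0] by exact: expectation_ge0.
have mean_fin : 'E_P[X i0] \is a fin_num.
  rewrite ge0_fin_numE// ltey; apply: contra_neq Mfin => mean_oo.
  by move: term_le; rewrite mean_oo gt0_muley ?lte_fin// leye_eq => /eqP.
have M_fin : expected_lin_sup T X \is a fin_num.
  rewrite ge0_fin_numE ?ltey//; apply: le_trans term_le.
  by rewrite mule_ge0// lee_fin ltW.
pose mu := fine 'E_P[X i0]; pose M := fine (expected_lin_sup T X).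
have muE i : 'E_P[X i] = mu%:E by rewrite meanE fineK.
have ME : expected_lin_sup T X = M%:E by rewrite fineK.
have X_tail' i t : (K * mu <= t)%R ->
    C%:E * P [set w | (2 * t <= X i w)%R] <= P [set w | (t <= X i w)%R].
  by move=> Kt; apply: X_tail; rewrite muE -EFinM lee_fin.
(* At [t = 0] the tail condition would read [C <= 1]. *)
have mu_gt0 : (0 < mu)%R.
  rewrite lt_neqAle -lee_fin -[mu%:E](muE i0) mean_ge0 andbT; apply/eqP => mu0.
  have := X_tail' i0 0%R; rewrite -mu0 !mulr0 lexx => /(_ isT).
  rewrite (_ : [set w | _] = setT); last first.
    by apply/seteqP; split => // w _; exact: X_nonneg.
  by rewrite probability_setT mule1 lee_fin leNgt C_gt1.
have M_gt0 : (0 < M)%R.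
  by rewrite -lte_fin -ME (lt_le_trans _ term_le)// muE -EFinM lte_fin mulr_gt0.
apply: (cover_finite_expectation delta_gt0 delta_lt1 C_gt1 K_ge1 j_large T_nonneg
  _ X_nonneg X_indep X_tail' muE mu_gt0 ME M_gt0).
by exists t0.
Qed.
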